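(* Let $G=(V,E,\omega)$ be a finite undirected connected weighted graph, let $\emptyset\neq U\subseteq V$ and let $u\colon V\to\mathbb{R}$. Then $u$ is discrete $\infty$-harmonic if and only if $\Delta_{\omega,\infty}u(x)=0$ for all $x\in V\setminus U$.
   Context: $G=(V,E,\omega)$ is a finite undirected connected weighted graph with symmetric weights $\omega(x,y)\in[0,1]$, where $\omega(x,y)=0$ if and only if $(x,y)\notin E$; write $x\sim y$ iff $(x,y)\in E$. Put $a^+=\max(a,0)$ and $a^-=-\min(a,0)$. A function $u\colon V\to\mathbb{R}$ is called discrete $\infty$-harmonic (with respect to $U$) if for all $x\in V\setminus U$ $$u(x)\in\operatorname*{arg\,min}_{a\in\mathbb{R}}\Big\{\max_{y\sim x}\sqrt{\omega(x,y)}\,|u(y)-a|\Big\}.$$ The graph $\infty$-Laplace operator is $$\Delta_{\omega,\infty}u(x)=\frac12\Big(\max_{y\sim x}\big(\sqrt{\omega(x,y)}\,(u(y)-u(x))^+\big)-\max_{y\sim x}\big(\sqrt{\omega(x,y)}\,(u(y)-u(x))^-\big)\Big).$$ *)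

(* Defs.v *)
From mathcomp Require Import all_boot all_order all_algebra.
From mathcomp Require Import reals.

Set Implicit Arguments.
Unset Strict Implicit.
Unset Printing Implicit Defensive.

Import Order.TTheory GRing.Theory Num.Theory.
Local Open Scope ring_scope.

(* Loops are neither required nor forbidden. *)
Record wgraph (R : realType) (V : finType) := WGraph {
  edge : rel V;
  weight : V -> V -> R;
  edge_sym : symmetric edge;
  weight_sym : forall x y, weight x y = weight y x;
  weight_itv01 : forall x y, 0 <= weight x y <= 1;
  weight_eq0 : forall x y, weight x y = 0 <-> ~~ edge x y;
  edge_connected : forall x y, connect edge x y
}.

Definition pos_part (R : realType) (a : R) : R := Num.max a 0.

Definition neg_part (R : realType) (a : R) : R := - Num.min a 0.

(* The base value 0 plays no role as soon as x has a neighbour and F is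
   nonnegative, which is the case in every use below (a vertex outside a
   nonempty U has a neighbour because the graph is connected). *)
Definition nbr_max (R : realType) (V : finType) (G : wgraph R V) (x : V)
    (F : V -> R) : R :=
  \big[Num.max/0]_(y | edge G x y) F y.

Definition is_argmin (R : realType) (f : R -> R) (a : R) : Prop :=
  forall b : R, f a <= f b.

Definition discrete_infty_harmonic (R : realType) (V : finType)
    (G : wgraph R V) (U : {set V}) (u : V -> R) : Prop :=
  forall x : V, x \notin U ->
    is_argmin
      (fun a : R => nbr_max G x (fun y => Num.sqrt (weight G x y) * `|u y - a|))
      (u x).

Definition infty_laplacian (R : realType) (V : finType) (G : wgraph R V)
    (u : V -> R) (x : V) : R :=
  2^-1 * (nbr_max G x (fun y => Num.sqrt (weight G x y) * pos_part (u y - u x))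
        - nbr_max G x (fun y => Num.sqrt (weight G x y) * neg_part (u y - u x))).

(* Main.v *)
Require Import Defs.
From mathcomp Require Import all_boot all_order all_algebra.
From mathcomp Require Import reals lra.

Set Implicit Arguments.
Unset Strict Implicit.
Unset Printing Implicit Defensive.

Import Order.TTheory GRing.Theory Num.Theory.
Local Open Scope ring_scope.

(** Both sides of the equivalence are conditions at a single vertex [x], about
    the cost [a |-> max_y sqrt(w(x,y)) |u(y) - a|] of the value [a] at [x].
    This cost is the maximum of an upward deviation, which only sees the
    neighbours with [u y > a] and is nonincreasing in [a], and a downward
    deviation, which is nondecreasing in [a]; the Laplacian at [x] is half
    their difference at [a = u x].

    If the two deviations agree at [c], then moving [a] to the left of [c]
    cannot decrease the upward one and moving it to the right cannot decrease
    the downward one, so [c] is a minimiser ([cost_min_of_balance]).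
    If the upward deviation strictly dominates at [c], moving [a] slightly to
    the right shrinks it, while the downward one grows at most as fast as [a]
    because the weights are at most 1; a small step therefore lowers the cost
    ([cost_improve]).  The reflection [u |-> - u], [a |-> - a] exchanges the
    two deviations and covers the case where the downward one dominates. *)

Definition cost (R : realType) (V : finType) (G : wgraph R V) (x : V)
    (u : V -> R) (a : R) : R :=
  nbr_max G x (fun y => Num.sqrt (weight G x y) * `|u y - a|).

Definition up_dev (R : realType) (V : finType) (G : wgraph R V) (x : V)
    (u : V -> R) (a : R) : R :=
  nbr_max G x (fun y => Num.sqrt (weight G x y) * pos_part (u y - a)).

(** Defined by reflection, so that every fact on [up_dev] transfers to it. *)
Definition down_dev (R : realType) (V : finType) (G : wgraph R V) (x : V)
    (u : V -> R) (a : R) : R :=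
  up_dev G x (fun y => - u y) (- a).

Lemma sqrt_weight_itv01 (R : realType) (V : finType) (G : wgraph R V)
    (x y : V) : 0 <= Num.sqrt (weight G x y) <= 1.
Proof.
have /andP[_ w1] := weight_itv01 G x y.
by rewrite sqrtr_ge0 -[leRHS]sqrtr1 ler_sqrt.
Qed.

Lemma sqrt_weight_gt0 (R : realType) (V : finType) (G : wgraph R V)
    (x y : V) : edge G x y -> 0 < Num.sqrt (weight G x y).
Proof.
move=> exy; have /andP[w0 _] := weight_itv01 G x y.
rewrite sqrtr_gt0 lt0r w0 andbT; apply/eqP => /weight_eq0.
by rewrite exy.
Qed.

Lemma le_nbr_max (R : realType) (V : finType) (G : wgraph R V) (x : V)
    (F F' : V -> R) : (forall y, F y <= F' y) ->
  nbr_max G x F <= nbr_max G x F'.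
Proof. by move=> leF; apply: le_bigmax2 => y _. Qed.

Lemma nbr_max_ge0 (R : realType) (V : finType) (G : wgraph R V) (x : V)
    (F : V -> R) : 0 <= nbr_max G x F.
Proof. exact: bigmax_ge_id. Qed.

Lemma pos_partN (R : realType) (a : R) : pos_part (- a) = neg_part a.
Proof. by rewrite /neg_part oppr_min oppr0. Qed.

Lemma normr_max_pos_part (R : realType) (a : R) :
  `|a| = Num.max (pos_part a) (pos_part (- a)).
Proof.
rewrite /pos_part; case: (lerP 0 a) => [a0|/ltW a0].
  by rewrite (@max_r _ _ (- a) 0) ?oppr_le0// (max_l a0) ger0_norm.
by rewrite (@max_l _ _ (- a) 0) ?oppr_ge0// max_r ?oppr_ge0// ler0_norm.
Qed.

Lemma down_devE (R : realType) (V : finType) (G : wgraph R V) (x : V)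
    (u : V -> R) (a : R) :
  down_dev G x u a =
  nbr_max G x (fun y => Num.sqrt (weight G x y) * neg_part (u y - a)).
Proof. by apply: eq_bigr => y _; rewrite -pos_partN opprD. Qed.

Lemma down_devN (R : realType) (V : finType) (G : wgraph R V) (x : V)
    (u : V -> R) (a : R) :
  down_dev G x (fun y => - u y) (- a) = up_dev G x u a.
Proof. by apply: eq_bigr => y _; rewrite !opprK. Qed.

Lemma costN (R : realType) (V : finType) (G : wgraph R V) (x : V)
    (u : V -> R) (a : R) : cost G x (fun y => - u y) (- a) = cost G x u a.
Proof. by apply: eq_bigr => y _; rewrite -opprD normrN. Qed.

Lemma cost_max_dev (R : realType) (V : finType) (G : wgraph R V) (x : V)
    (u : V -> R) (a : R) :
  cost G x u a = Num.max (up_dev G x u a) (down_dev G x u a).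
Proof.
rewrite /cost /down_dev /up_dev /nbr_max -bigmax_split.
apply: eq_bigr => y _.
by rewrite normr_max_pos_part maxr_pMr ?sqrtr_ge0// opprD.
Qed.

Lemma up_dev_le (R : realType) (V : finType) (G : wgraph R V) (x : V)
    (u : V -> R) (a b : R) : a <= b -> up_dev G x u b <= up_dev G x u a.
Proof.
move=> leab; apply: le_nbr_max => y; apply: ler_wpM2l; first exact: sqrtr_ge0.
by rewrite /pos_part le_max2// lerB.
Qed.

Lemma cost_min_of_balance (R : realType) (V : finType) (G : wgraph R V) (x : V)
    (u : V -> R) (c : R) : up_dev G x u c = down_dev G x u c ->
  is_argmin (cost G x u) c.
Proof.
move=> bal b; rewrite (cost_max_dev _ _ _ c) -bal maxxx cost_max_dev le_max.
case: (leP b c) => [/up_dev_le-> //|/ltW lecb].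
by rewrite bal [X in _ || X]up_dev_le ?orbT// lerN2.
Qed.

(** The step is half the gap [M - N] between the two deviations.  A neighbour
    still above the new value has lost a positive amount, its weight being
    positive; the others contribute at most [N] plus the step. *)
Lemma cost_improve (R : realType) (V : finType) (G : wgraph R V) (x : V)
    (u : V -> R) (c : R) : down_dev G x u c < up_dev G x u c ->
  exists b, cost G x u b < cost G x u c.
Proof.
move=> ltNM; rewrite (cost_max_dev _ _ _ c) (max_l (ltW ltNM)).
set M := up_dev G x u c in ltNM *; set N := down_dev G x u c in ltNM.
have N0 : 0 <= N by exact: nbr_max_ge0.
exists (c + (M - N) / 2); apply: bigmax_lt => [|y exy].
  exact: le_lt_trans ltNM.
have /andP[_ s1] := sqrt_weight_itv01 G x y.
have s0 := sqrt_weight_gt0 exy.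
have leM : Num.sqrt (weight G x y) * pos_part (u y - c) <= M.
  exact: (le_bigmax_cond _
    (fun y => Num.sqrt (weight G x y) * pos_part (u y - c))).
have leN : Num.sqrt (weight G x y) * pos_part (- u y - - c) <= N.
  exact: (le_bigmax_cond _
    (fun y => Num.sqrt (weight G x y) * pos_part (- u y - - c))).
have {}leM : Num.sqrt (weight G x y) * (u y - c) <= M.
  by apply: le_trans leM; rewrite ler_pM2l// le_max lexx.
have {}leN : Num.sqrt (weight G x y) * (- u y - - c) <= N.
  by apply: le_trans leN; rewrite ler_pM2l// le_max lexx.
move: (Num.sqrt _) s0 s1 leM leN => s s0 s1 leM leN.
have se0 : 0 < s * ((M - N) / 2) by apply: mulr_gt0 => //; lra.
have se1 : s * ((M - N) / 2) <= (M - N) / 2 by apply: ler_piMl => //; lra.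
by case: (ger0P (u y - (c + (M - N) / 2))) => _; lra.
Qed.

Lemma cost_argminP (R : realType) (V : finType) (G : wgraph R V) (x : V)
    (u : V -> R) (c : R) :
  is_argmin (cost G x u) c <-> up_dev G x u c = down_dev G x u c.
Proof.
split=> [minc|]; last exact: cost_min_of_balance.
case: (ltgtP (up_dev G x u c) (down_dev G x u c)) => // [ltMN|ltNM].
- have [|b] := @cost_improve _ _ G x (fun y => - u y) (- c).
    by rewrite down_devN.
  by rewrite costN -[b]opprK costN ltNge minc.
- by have [b] := cost_improve ltNM; rewrite ltNge minc.
Qed.

Lemma infty_laplacian_eq0 (R : realType) (V : finType) (G : wgraph R V)
    (u : V -> R) (x : V) :
  infty_laplacian G u x = 0 <-> up_dev G x u (u x) = down_dev G x u (u x).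
Proof.
rewrite /infty_laplacian -down_devE -/(up_dev G x u (u x)).
split=> [/eqP|->]; last by rewrite subrr mulr0.
by rewrite mulf_eq0 invr_eq0 pnatr_eq0 /= subr_eq0 => /eqP.
Qed.

Theorem theorem5p4 (R : realType) (V : finType) (G : wgraph R V)
    (U : {set V}) (u : V -> R) (hU : U != set0) :
  discrete_infty_harmonic G U u <->
  (forall x : V, x \notin U -> infty_laplacian G u x = 0).
Proof.
split=> H x xU.
- by apply/infty_laplacian_eq0/cost_argminP; exact: H.
- by apply/cost_argminP/infty_laplacian_eq0; exact: H.
Qed.
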